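(* Let $(X,r)$ be a finite multipermutation solution of the YBE. If the structure group $G=G(X,r)$ is nilpotent (i.e. $(G,\circ)$ is a nilpotent group), then the torsion subgroup $T(G)$ of $(G,\circ)$ is finite and equal to the additive commutator subgroup $[G,G]_+$, i.e. the commutator subgroup of the group $(G,+)=A_{\mathrm{gr}}(X,r)$.
   Context: A solution of the YBE is a pair $(X,r)$ with $X$ a non-empty set and $r\colon X^2\to X^2$, $r(x,y)=(\lambda_x(y),\rho_y(x))$, a bijective map such that all $\lambda_x,\rho_y$ are bijective and $(r\times\mathrm{id})(\mathrm{id}\times r)(r\times\mathrm{id})=(\mathrm{id}\times r)(r\times\mathrm{id})(\mathrm{id}\times r)$ on $X^3$. It is finite if $X$ is finite. Retract and multipermutation solutions: define $x\sim y$ iff $\lambda_x=\lambda_y$ and $\rho_x=\rho_y$. Then $r$ induces a solution $\overline r(\overline x,\overline y)=(\overline{\lambda_x(y)},\overline{\rho_y(x)})$ of the YBE on $X/{\sim}$, denoted $\mathrm{Ret}(X,r)$. Put $\mathrm{Ret}^0(X,r)=(X,r)$ and $\mathrm{Ret}^n(X,r)=\mathrm{Ret}(\mathrm{Ret}^{n-1}(X,r))$. $(X,r)$ is a multipermutation solution if some $\mathrm{Ret}^m(X,r)$, $m\ge 0$, has exactly one element. $G=G(X,r)$ is the group generated by $X$ with relations $x\circ y=\lambda_x(y)\circ\rho_y(x)$. $A_{\mathrm{gr}}(X,r)$ is the group, written additively, generated by $X$ with relations $x+\lambda_x(y)=\lambda_x(y)+\lambda_{\lambda_x(y)}(\rho_y(x))$.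 $G$ acts on $A_{\mathrm{gr}}(X,r)$ by automorphisms $\lambda^{e'}_g$, where $x\in X$ acts on generators as $\lambda_x$, and there is a bijective $1$-cocycle $\pi\colon G\to A_{\mathrm{gr}}(X,r)$, $\pi(g\circ h)=\pi(g)+\lambda^{e'}_g(\pi(h))$, that is the identity on generators. The addition on $G$ is $a+b=\pi^{-1}(\pi(a)+\pi(b))$; then $(G,+,\circ)$ is a skew left brace (both operations are group operations and $a\circ(b+c)=(a\circ b)-a+(a\circ c)$), and $(G,+)$ is identified with $A_{\mathrm{gr}}(X,r)$ via $\pi$. For a group $H$, $T(H)$ denotes the set of its elements of finite order. *)

(* Defs.v *)
(* Finite solutions of the Yang-Baxter equation, their retracts, and the skew
   left brace structure on their structure groups. *)
From HB Require Import structures.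
From mathcomp Require Import all_boot.
From mathcomp Require Import boolp classical_sets functions cardinality.

Set Implicit Arguments.
Unset Strict Implicit.
Unset Printing Implicit Defensive.

Local Open Scope quotient_scope.
Local Open Scope group_scope.

Section Solutions.
Variable X : Type.
Implicit Type r : X * X -> X * X.

Definition lam r (x y : X) : X := (r (x, y)).1.
Definition rho r (y x : X) : X := (r (x, y)).2.

Definition r_id r (t : X * X * X) : X * X * X :=
  let: (x, y, z) := t in (r (x, y), z).
Definition id_r r (t : X * X * X) : X * X * X :=
  let: (x, y, z) := t in (x, (r (y, z)).1, (r (y, z)).2).

Definition ybe r : Prop :=
  forall t, r_id r (id_r r (r_id r t)) = id_r r (r_id r (id_r r t)).

Definition is_solution r : Prop :=
  [/\ inhabited X, bijective r, forall x, bijective (lam r x),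
      forall y, bijective (rho r y) & ybe r].

End Solutions.

Record finSolution := FinSolution {
  sol_carrier :> finType;
  sol_map : sol_carrier * sol_carrier -> sol_carrier * sol_carrier;
  sol_axiom : is_solution sol_map
}.

Notation "'λ_[' S ]" := (lam (@sol_map S)) (format "'λ_[' S ]").
Notation "'ρ_[' S ]" := (rho (@sol_map S)) (format "'ρ_[' S ]").

Section SolutionTheory.
Variable S : finSolution.
Implicit Types x y z : S.

Lemma sol_inh : inhabited S. Proof. by case: (sol_axiom S). Qed.
Lemma sol_bij : bijective (@sol_map S). Proof. by case: (sol_axiom S). Qed.
Lemma lam_inj x : injective (λ_[S] x).
Proof. by case: (sol_axiom S) => _ _ h _ _; apply: bij_inj. Qed.
Lemma rho_inj y : injective (ρ_[S] y).
Proof. by case: (sol_axiom S) => _ _ _ h _; apply: bij_inj. Qed.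

Lemma ybe1 x y z :
  λ_[S] x (λ_[S] y z) = λ_[S] (λ_[S] x y) (λ_[S] (ρ_[S] y x) z).
Proof.
case: (sol_axiom S) => _ _ _ _ /(_ (x, y, z)).
rewrite /r_id /id_r /lam /rho /=.
case: (sol_map (x, y)) => a b /=; case: (sol_map (y, z)) => c d /=.
case: (sol_map (b, z)) => e f /=; case: (sol_map (x, c)) => g h /=.
by case: (sol_map (a, e)) => ? ? /=; case: (sol_map (h, d)) => ? ? /= [].
Qed.

Lemma ybe2 x y z :
  ρ_[S] (λ_[S] (ρ_[S] y x) z) (λ_[S] x y) =
  λ_[S] (ρ_[S] (λ_[S] y z) x) (ρ_[S] z y).
Proof.
case: (sol_axiom S) => _ _ _ _ /(_ (x, y, z)).
rewrite /r_id /id_r /lam /rho /=.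
case: (sol_map (x, y)) => a b /=; case: (sol_map (y, z)) => c d /=.
case: (sol_map (b, z)) => e f /=; case: (sol_map (x, c)) => g h /=.
by case: (sol_map (a, e)) => ? ? /=; case: (sol_map (h, d)) => ? ? /= [].
Qed.

Lemma ybe3 x y z :
  ρ_[S] z (ρ_[S] y x) = ρ_[S] (ρ_[S] z y) (ρ_[S] (λ_[S] y z) x).
Proof.
case: (sol_axiom S) => _ _ _ _ /(_ (x, y, z)).
rewrite /r_id /id_r /lam /rho /=.
case: (sol_map (x, y)) => a b /=; case: (sol_map (y, z)) => c d /=.
case: (sol_map (b, z)) => e f /=; case: (sol_map (x, c)) => g h /=.
by case: (sol_map (a, e)) => ? ? /=; case: (sol_map (h, d)) => ? ? /= [].
Qed.

End SolutionTheory.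

Section Retract.
Variable S : finSolution.
Implicit Types x y z : S.

Definition retract_rel : rel S := fun x y =>
  [forall z, λ_[S] x z == λ_[S] y z] && [forall z, ρ_[S] x z == ρ_[S] y z].

Lemma retract_relP x y :
  reflect (λ_[S] x =1 λ_[S] y /\ ρ_[S] x =1 ρ_[S] y) (retract_rel x y).
Proof.
apply: (iffP andP) => -[h k].
  by split=> z; apply/eqP; [apply: (forallP h)|apply: (forallP k)].
by split; apply/forallP => z; apply/eqP.
Qed.

Lemma retract_refl : reflexive retract_rel.
Proof. by move=> x; apply/retract_relP. Qed.

Lemma retract_sym : symmetric retract_rel.
Proof.
have h x y : retract_rel x y -> retract_rel y x.
  by move=> /retract_relP[h k]; apply/retract_relP; split.
by move=> x y; apply/idP/idP; apply: h.
Qed.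

Lemma retract_trans : transitive retract_rel.
Proof.
move=> y x z /retract_relP[h k] /retract_relP[h' k'].
by apply/retract_relP; split; move=> t; rewrite ?h ?k ?h' ?k'.
Qed.

Canonical retract_equiv :=
  EquivRel retract_rel retract_refl retract_sym retract_trans.

Definition retract_type := {eq_quot retract_equiv}.

Definition retract_pi (x : S) : retract_type := \pi_{eq_quot retract_equiv} x.
Definition retract_repr (a : retract_type) : S :=
  repr (a : {eq_quot retract_equiv}).

Lemma retract_reprK : cancel retract_repr retract_pi.
Proof. exact: reprK. Qed.

HB.instance Definition _ :=
  Finite.copy retract_type (can_type retract_reprK).

Lemma retract_piP x y :
  retract_pi x = retract_pi y <-> λ_[S] x =1 λ_[S] y /\ ρ_[S] x =1 ρ_[S] y.
Proof.
rewrite /retract_pi; split=> [/eqmodP/retract_relP //|h].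
by apply/eqmodP/retract_relP.
Qed.

Definition retract_map (p : retract_type * retract_type) :=
  (retract_pi (λ_[S] (retract_repr p.1) (retract_repr p.2)),
   retract_pi (ρ_[S] (retract_repr p.2) (retract_repr p.1))).

Lemma retract_lam_congr x x' y y' :
  retract_pi x = retract_pi x' -> retract_pi y = retract_pi y' ->
  retract_pi (λ_[S] x y) = retract_pi (λ_[S] x' y').
Proof.
move=> /retract_piP[h k] /retract_piP[h' k']; rewrite h; apply/retract_piP.
split=> z.
  case: (sol_axiom S) => _ _ /(_ (ρ_[S] y x'))[g _ gK] _ _.
  by rewrite -[z]gK -ybe1 h' [in RHS]k' -ybe1.
by apply: (@rho_inj S (ρ_[S] y x')); rewrite -ybe3 k' [in RHS]k' -ybe3.
Qed.

Lemma retract_rho_congr x x' y y' :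
  retract_pi x = retract_pi x' -> retract_pi y = retract_pi y' ->
  retract_pi (ρ_[S] y x) = retract_pi (ρ_[S] y' x').
Proof.
move=> /retract_piP[h k] /retract_piP[h' k']; rewrite k'; apply/retract_piP.
split=> z.
  apply: (@lam_inj S (λ_[S] x y')).
  by rewrite -ybe1 h [in RHS]h -ybe1.
case: (sol_axiom S) => _ _ _ /(_ (λ_[S] x y'))[g _ gK] _.
by rewrite -[z]gK -ybe3 k [in RHS]h -ybe3.
Qed.

(* The induced map on classes; in particular [retract_map] does not depend on
   the representatives used to define it. *)
Lemma retract_mapE x y :
  retract_map (retract_pi x, retract_pi y) =
  (retract_pi (λ_[S] x y), retract_pi (ρ_[S] y x)).
Proof.
by congr pair; [apply: retract_lam_congr|apply: retract_rho_congr];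
  rewrite retract_reprK.
Qed.

Lemma fin_surj_bij (T : finType) (f g : T -> T) : cancel g f -> bijective f.
Proof.
move=> gK; have [h gh hg] := injF_bij (can_inj gK).
by exists g => // x; rewrite -[x]hg gK.
Qed.

Lemma retract_is_solution : is_solution retract_map.
Proof.
have E := retract_mapE; have K := retract_reprK.
split.
- by case: (sol_inh S) => x; exists; apply: retract_pi.
- have [f _ fK] := sol_bij S.
  pose g (p : retract_type * retract_type) :=
    let q := f (retract_repr p.1, retract_repr p.2) in
    (retract_pi q.1, retract_pi q.2).
  apply: (@fin_surj_bij _ _ g) => -[a b]; rewrite /g E /lam /rho /=.
  by rewrite -surjective_pairing fK !K.
- move=> a; case: (sol_axiom S) => _ _ /(_ (retract_repr a))[f _ fK] _ _.
  apply: (@fin_surj_bij _ _ (fun b => retract_pi (f (retract_repr b)))) => b.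
  by rewrite /lam -{1}[a]K E /= fK K.
- move=> a; case: (sol_axiom S) => _ _ _ /(_ (retract_repr a))[f _ fK] _.
  apply: (@fin_surj_bij _ _ (fun b => retract_pi (f (retract_repr b)))) => b.
  by rewrite /rho -{1}[a]K E /= fK K.
- case=> -[a b] c; rewrite -[a]K -[b]K -[c]K.
  move: (retract_repr a) (retract_repr b) (retract_repr c) => x y z.
  rewrite /r_id /id_r; do 10 rewrite ?E /=.
  by rewrite -ybe1 ybe2 ybe3.
Qed.

Definition retract : finSolution := FinSolution retract_is_solution.

End Retract.

Definition iter_retract (n : nat) (S : finSolution) : finSolution :=
  iter n retract S.

Definition multipermutation (S : finSolution) : Prop :=
  exists m : nat, #|iter_retract m S| = 1%N.

(* The group presented by the generators X and the relations u = v, for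
   [R u v].  Words are sequences of signed letters; [(true, x)] stands for the
   formal inverse of x. *)
Section Presentation.
Variable X : choiceType.
Definition word := seq (bool * X).
Variable R : word -> word -> Prop.

Inductive word_cong : word -> word -> Prop :=
| cong_refl u : word_cong u u
| cong_sym u v : word_cong u v -> word_cong v u
| cong_trans v u w : word_cong u v -> word_cong v w -> word_cong u w
| cong_cat u u' v v' :
    word_cong u u' -> word_cong v v' -> word_cong (u ++ v) (u' ++ v')
| cong_cancel b x : word_cong [:: (b, x); (~~ b, x)] [::]
| cong_rel u v : R u v -> word_cong u v.

Definition word_congb : rel word := fun u v => `[< word_cong u v >].

Lemma word_congb_refl : reflexive word_congb.
Proof. by move=> u; apply/asboolP; apply: cong_refl. Qed.
Lemma word_congb_sym : symmetric word_congb.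
Proof.
by move=> u v; apply/idP/idP => /asboolP h; apply/asboolP; apply: cong_sym.
Qed.
Lemma word_congb_trans : transitive word_congb.
Proof.
by move=> v u w /asboolP h /asboolP k; apply/asboolP; apply: cong_trans h k.
Qed.

Canonical word_equiv :=
  EquivRel word_congb word_congb_refl word_congb_sym word_congb_trans.

Definition presented := {eq_quot word_equiv}.
HB.instance Definition _ := Choice.on presented.

Definition wclass (w : word) : presented := \pi_{eq_quot word_equiv} w.
Definition wrepr (g : presented) : word := repr (g : {eq_quot word_equiv}).

Lemma wreprK : cancel wrepr wclass. Proof. exact: reprK. Qed.

Lemma wclassP u v : wclass u = wclass v <-> word_cong u v.
Proof.
rewrite /wclass; split=> [/eqmodP/asboolP //|h].
by apply/eqmodP/asboolP.
Qed.

Lemma wreprP w : word_cong (wrepr (wclass w)) w.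
Proof. by apply/wclassP; rewrite wreprK. Qed.

Definition winv (w : word) : word := rev [seq (~~ p.1, p.2) | p <- w].

Lemma winvK : involutive winv.
Proof.
move=> w; rewrite /winv map_rev revK -map_comp -[RHS]map_id.
by apply: eq_map => -[b x] /=; rewrite negbK.
Qed.

Lemma word_cong_mulV w : word_cong (w ++ winv w) [::].
Proof.
elim: w => [|[b x] w IH]; first exact: cong_refl.
rewrite /winv /= rev_cons -cats1 -/(winv w).
rewrite -cat1s (catA w) -[X in word_cong _ X](cat0s [::]).
apply: (@cong_trans ([:: (b, x)] ++ ([::] ++ [:: (~~ b, x)]))).
  by apply: cong_cat (cong_refl _) (cong_cat IH (cong_refl _)).
exact: cong_cancel.
Qed.

Lemma word_cong_mulVl w : word_cong (winv w ++ w) [::].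
Proof. by rewrite -{2}[w]winvK; apply: word_cong_mulV. Qed.

Definition pres_one : presented := wclass [::].
Definition pres_mul (g h : presented) := wclass (wrepr g ++ wrepr h).
Definition pres_inv (g : presented) := wclass (winv (wrepr g)).

Lemma pres_mulE u v : pres_mul (wclass u) (wclass v) = wclass (u ++ v).
Proof. by apply/wclassP; apply: cong_cat; apply: wreprP. Qed.

Lemma pres_mulA : associative pres_mul.
Proof.
by move=> a b c; rewrite -[a]wreprK -[b]wreprK -[c]wreprK !pres_mulE catA.
Qed.
Lemma pres_mul1 : left_id pres_one pres_mul.
Proof. by move=> a; rewrite -[a]wreprK pres_mulE. Qed.
Lemma pres_1mul : right_id pres_one pres_mul.
Proof. by move=> a; rewrite -[a]wreprK pres_mulE cats0. Qed.
Lemma pres_mulV : left_inverse pres_one pres_inv pres_mul.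
Proof.
move=> a; rewrite -{2}[a]wreprK pres_mulE.
by apply/wclassP; apply: word_cong_mulVl.
Qed.
Lemma pres_Vmul : right_inverse pres_one pres_inv pres_mul.
Proof.
move=> a; rewrite -{1}[a]wreprK pres_mulE.
by apply/wclassP; apply: word_cong_mulV.
Qed.

HB.instance Definition _ := isGroup.Build presented
  pres_mulA pres_mul1 pres_1mul pres_mulV pres_Vmul.

Definition pgen (x : X) : presented := wclass [:: (false, x)].

Lemma pgenV x : (pgen x)^-1 = wclass [:: (true, x)].
Proof.
apply: (@mulgI _ (pgen x)); rewrite mulgV.
by rewrite [RHS]pres_mulE; apply/wclassP/cong_sym; apply: cong_cancel.
Qed.

Lemma pres_ind (P : presented -> Prop) :
  P 1 -> (forall x g, P g -> P (pgen x * g)) ->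
  (forall x g, P g -> P ((pgen x)^-1 * g)) -> forall g, P g.
Proof.
move=> P1 PM PV g; rewrite -[g]wreprK.
elim: (wrepr g) => [//|[[] x] w IH].
- by move: (PV x _ IH); rewrite pgenV [_ * _]pres_mulE.
- by move: (PM x _ IH); rewrite [_ * _]pres_mulE.
Qed.

(* A family of permutations of T indexed by the generators and satisfying the
   relations defines a left action of the presented group on T. *)
Section Action.
Variables (T : Type) (f f' : X -> T -> T).

Definition wact (w : word) (t : T) : T :=
  foldr (fun p s => if p.1 then f' p.2 s else f p.2 s) t w.

Definition pact (g : presented) (t : T) : T := wact (wrepr g) t.

Lemma wact_cat u v t : wact (u ++ v) t = wact u (wact v t).
Proof. exact: foldr_cat. Qed.

Hypothesis fK : forall x, cancel (f x) (f' x).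
Hypothesis f'K : forall x, cancel (f' x) (f x).
Hypothesis fR : forall u v, R u v -> wact u =1 wact v.

Lemma wact_cong u v : word_cong u v -> wact u =1 wact v.
Proof.
elim=> {u v} // [u v _ IH t|v u w _ IH _ IH' t|u u' v v' _ IH _ IH' t|b x t].
- by rewrite IH.
- by rewrite IH IH'.
- by rewrite !wact_cat IH' IH.
- by case: b => /=; rewrite ?fK ?f'K.
Qed.

Lemma pactE w : pact (wclass w) =1 wact w.
Proof. exact/wact_cong/wreprP. Qed.

Lemma pact1 t : pact 1 t = t. Proof. exact: pactE. Qed.
Lemma pactM g h t : pact (g * h) t = pact g (pact h t).
Proof.
rewrite -[g]wreprK -[h]wreprK [wclass _ * wclass _]pres_mulE !pactE.
exact: wact_cat.
Qed.
Lemma pact_gen x t : pact (pgen x) t = f x t.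
Proof. exact: pactE. Qed.
Lemma pact_genV x t : pact (pgen x)^-1 t = f' x t.
Proof. by rewrite pgenV pactE. Qed.
Lemma pactK g : cancel (pact g) (pact g^-1).
Proof. by move=> t; rewrite -pactM mulVg pact1. Qed.
Lemma pactVK g : cancel (pact g^-1) (pact g).
Proof. by move=> t; rewrite -pactM mulgV pact1. Qed.

End Action.

(* The homomorphism to H extending a map on generators. *)
Section Lift.
Variables (H : groupType) (phi : X -> H).

Definition lift_gen x h := phi x * h.
Definition lift_genV x h := (phi x)^-1 * h.
Definition plift (g : presented) : H := pact lift_gen lift_genV g 1.

Hypothesis phiR : forall u v, R u v ->
  wact lift_gen lift_genV u =1 wact lift_gen lift_genV v.

Let phiK x : cancel (lift_gen x) (lift_genV x).
Proof. exact: mulKg. Qed.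
Let phiVK x : cancel (lift_genV x) (lift_gen x).
Proof. exact: mulVKg. Qed.

Lemma plift1 : plift 1 = 1. Proof. exact: pact1. Qed.
Lemma plift_gen x : plift (pgen x) = phi x.
Proof. by rewrite /plift pact_gen // /lift_gen mulg1. Qed.
Lemma pliftM g h : plift (g * h) = plift g * plift h.
Proof.
rewrite {1 3}/plift pactM // -/(plift h); move: (plift h) => {}h.
elim/pres_ind: g => [|x g IH|x g IH].
- by rewrite plift1 pact1 ?mul1g.
- by rewrite /plift !pactM // !pact_gen // IH /lift_gen /plift mulgA.
- by rewrite /plift !pactM // !pact_genV // IH /lift_genV /plift mulgA.
Qed.

End Lift.

Lemma presented_morph_ext (H : groupType) (p q : presented -> H) :
  {morph p : a b / a * b} -> {morph q : a b / a * b} ->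
  (forall x, p (pgen x) = q (pgen x)) -> p =1 q.
Proof.
move=> pM qM pq.
have p1 : p 1 = 1 by apply: (@mulgI _ (p 1)); rewrite -pM !mulg1.
have q1 : q 1 = 1 by apply: (@mulgI _ (q 1)); rewrite -qM !mulg1.
elim/pres_ind => [|x g IH|x g IH]; first by rewrite p1 q1.
  by rewrite pM qM pq IH.
rewrite pM qM IH; congr (_ * _); apply: (@mulgI _ (p (pgen x))).
by rewrite -pM mulgV p1 pq -qM mulgV q1.
Qed.

End Presentation.

Section StructureGroup.
Variable S : finSolution.
Implicit Types x y z : S.

Definition letter x : bool * S := (false, x).

Definition structure_rel (u v : word S) : Prop := exists x y,
  u = [:: letter x; letter y] /\
  v = [:: letter (λ_[S] x y); letter (ρ_[S] y x)].

Definition derived_rel (u v : word S) : Prop := exists x y,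
  u = [:: letter x; letter (λ_[S] x y)] /\
  v = [:: letter (λ_[S] x y); letter (λ_[S] (λ_[S] x y) (ρ_[S] y x))].

(* G(X,r) *)
Definition structure_group : groupType := presented structure_rel.
(* A_gr(X,r); its operation + is written multiplicatively. *)
Definition derived_group : groupType := presented derived_rel.

Definition sgen x : structure_group := pgen structure_rel x.
Definition dgen x : derived_group := pgen derived_rel x.

Lemma sgenE x y : sgen x * sgen y = sgen (λ_[S] x y) * sgen (ρ_[S] y x).
Proof.
rewrite [LHS]pres_mulE [RHS]pres_mulE.
by apply/wclassP/cong_rel; exists x, y.
Qed.

Lemma dgenE x y : dgen x * dgen (λ_[S] x y) =
  dgen (λ_[S] x y) * dgen (λ_[S] (λ_[S] x y) (ρ_[S] y x)).
Proof.
rewrite [LHS]pres_mulE [RHS]pres_mulE.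
by apply/wclassP/cong_rel; exists x, y.
Qed.

Definition lamV x : S -> S := invF (@lam_inj S x).
Lemma lamK x : cancel (λ_[S] x) (lamV x). Proof. exact: invF_f. Qed.
Lemma lamVK x : cancel (lamV x) (λ_[S] x). Proof. exact: f_invF. Qed.

(* The action of G on X in which x acts as λ_x. *)
Definition actX : structure_group -> S -> S := pact (lam (@sol_map S)) lamV.

Lemma actX_rel u v : structure_rel u v ->
  wact (lam (@sol_map S)) lamV u =1 wact (lam (@sol_map S)) lamV v.
Proof. by move=> [x [y [-> ->]]] t /=; apply: ybe1. Qed.

Lemma actX1 x : actX 1 x = x.
Proof. by apply: pact1 => //; [exact: lamK|exact: lamVK|exact: actX_rel]. Qed.
Lemma actXM g h x : actX (g * h) x = actX g (actX h x).
Proof. by apply: pactM; [exact: lamK|exact: lamVK|exact: actX_rel]. Qed.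
Lemma actX_gen x : actX (sgen x) =1 λ_[S] x.
Proof. by apply: pact_gen; [exact: lamK|exact: lamVK|exact: actX_rel]. Qed.
Lemma actXK g : cancel (actX g) (actX g^-1).
Proof. by move=> x; rewrite -actXM mulVg actX1. Qed.
Lemma actXVK g : cancel (actX g^-1) (actX g).
Proof. by move=> x; rewrite -actXM mulgV actX1. Qed.

(* [dop z x] is the letter w such that x + z = z + w in A_gr(X,r). *)
Definition dop z x : S := λ_[S] z (ρ_[S] (lamV x z) x).

Lemma sigE x y : dop (λ_[S] x y) x = λ_[S] (λ_[S] x y) (ρ_[S] y x).
Proof. by rewrite /dop lamK. Qed.

Lemma lam_sig a z x : λ_[S] a (dop z x) = dop (λ_[S] a z) (λ_[S] a x).
Proof.
rewrite -[z](lamVK x); move: (lamV x z) => y.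
by rewrite sigE [λ_[S] a (λ_[S] x y)]ybe1 sigE ybe2 -!ybe1.
Qed.

Lemma actX_sig g z x : actX g (dop z x) = dop (actX g z) (actX g x).
Proof.
elim/pres_ind: g => [|a g IH|a g IH].
- by rewrite !actX1.
- by rewrite !actXM IH -/(sgen a) !actX_gen lam_sig.
- rewrite !actXM IH -/(sgen a); apply: (can_inj (actXK (sgen a))).
  by rewrite actXVK !actX_gen lam_sig -!actX_gen !actXVK.
Qed.

Lemma dgen_sig x z : dgen x * dgen z = dgen z * dgen (dop z x).
Proof.
rewrite -[z](lamVK x); move: (lamV x z) => y.
by rewrite sigE dgenE.
Qed.

(* λ^{e'}_g, the endomorphism of A_gr(X,r) permuting the generators by the
   action of g on X. *)
Definition lamA (g : structure_group) : derived_group -> derived_group :=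
  plift (R := derived_rel) (fun x => dgen (actX g x)).

Lemma lamA_rel g u v : derived_rel u v ->
  wact (lift_gen (fun x => dgen (actX g x)))
       (lift_genV (fun x => dgen (actX g x))) u =1
  wact (lift_gen (fun x => dgen (actX g x)))
       (lift_genV (fun x => dgen (actX g x))) v.
Proof.
move=> [x [y [-> ->]]] t; rewrite /= /lift_gen !mulgA; congr (_ * _).
by rewrite -sigE actX_sig dgen_sig.
Qed.

Lemma lamAM g : {morph lamA g : a b / a * b}.
Proof. exact: pliftM (@lamA_rel g). Qed.
Lemma lamA_1 g : lamA g 1 = 1.
Proof. exact: plift1 (@lamA_rel g). Qed.
Lemma lamA_gen g x : lamA g (dgen x) = dgen (actX g x).
Proof. exact: plift_gen (@lamA_rel g) x. Qed.
Lemma lamA_sgen x y : lamA (sgen x) (dgen y) = dgen (λ_[S] x y).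
Proof. by rewrite lamA_gen actX_gen. Qed.
Lemma lamA1 : lamA 1 =1 id.
Proof.
apply: presented_morph_ext => // [|x]; first exact: lamAM.
by rewrite -/(dgen x) lamA_gen actX1.
Qed.
Lemma lamA_comp g h a : lamA (g * h) a = lamA g (lamA h a).
Proof.
move: a; apply: presented_morph_ext => [|a b|x]; first exact: lamAM.
- by rewrite !lamAM.
- by rewrite -/(dgen x) !lamA_gen actXM.
Qed.
Lemma lamAK g : cancel (lamA g) (lamA g^-1).
Proof. by move=> a; rewrite -lamA_comp mulVg lamA1. Qed.
Lemma lamAVK g : cancel (lamA g^-1) (lamA g).
Proof. by move=> a; rewrite -lamA_comp mulgV lamA1. Qed.

(* The 1-cocycle π : G -> A_gr(X,r) is the orbit map at 0 of the affine action
   of G on A_gr(X,r) in which the generator x acts as a |-> x + λ_x(a).  It is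
   characterized by [pi_cocycle] and [pi_gen]. *)
Definition affx x (a : derived_group) := dgen x * lamA (sgen x) a.
Definition affxV x (a : derived_group) := lamA (sgen x)^-1 ((dgen x)^-1 * a).

Lemma affxK x : cancel (affx x) (affxV x).
Proof. by move=> a; rewrite /affx /affxV mulKg lamAK. Qed.
Lemma affxVK x : cancel (affxV x) (affx x).
Proof. by move=> a; rewrite /affx /affxV lamAVK mulVKg. Qed.
Lemma affx_rel u v : structure_rel u v -> wact affx affxV u =1 wact affx affxV v.
Proof.
move=> [x [y [-> ->]]] a; rewrite /= /affx !lamAM !lamA_sgen !mulgA.
by rewrite -!lamA_comp sgenE dgenE.
Qed.

Definition brace_pi (g : structure_group) : derived_group := pact affx affxV g 1.

Lemma pi_gen x : brace_pi (sgen x) = dgen x.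
Proof.
rewrite /brace_pi pact_gen; [|exact: affxK|exact: affxVK|exact: affx_rel].
by rewrite /affx lamA_1 mulg1.
Qed.

Lemma pi_cocycle g h :
  brace_pi (g * h) = brace_pi g * lamA g (brace_pi h).
Proof.
rewrite {1}/brace_pi pactM; [|exact: affxK|exact: affxVK|exact: affx_rel].
rewrite -/(brace_pi h); move: (brace_pi h) => a.
have aM := pactM affxK affxVK affx_rel.
elim/pres_ind: g => [|x g IH|x g IH].
- by rewrite /brace_pi !pact1 ?lamA1 ?mul1g //;
    [exact: affxK|exact: affxVK|exact: affx_rel|exact: affxK|exact: affxVK
    |exact: affx_rel].
- rewrite aM IH /brace_pi aM -/(brace_pi g).
  rewrite !(pact_gen affxK affxVK affx_rel).
  by rewrite /affx lamAM lamA_comp mulgA.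
- rewrite aM IH /brace_pi aM -/(brace_pi g).
  rewrite !(pact_genV affxK affxVK affx_rel).
  by rewrite /affxV lamA_comp -lamAM mulgA.
Qed.

Lemma pi1 : brace_pi 1 = 1.
Proof.
apply: (@mulgI _ (brace_pi 1)); rewrite mulg1 -{2}[brace_pi 1]lamA1.
by rewrite -pi_cocycle mulg1.
Qed.

(* The inverse of π comes from the right action of A_gr(X,r) on G in which the
   generator x acts as g |-> g + x = g ∘ λ_g^{-1}(x). *)
Definition diag x : S := lamV x x.

Lemma diag_inj : injective diag.
Proof.
have E u : ρ_[S] (diag u) u = dop (diag u) (diag u).
  apply: (@lam_inj S u); rewrite lam_sig.
  by rewrite [in RHS]/diag lamVK -[X in dop X u](lamVK u) sigE lamVK.
move=> u v uv; apply: (@rho_inj S (diag u)); rewrite E [in RHS]uv E.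
by rewrite uv.
Qed.

Definition diagV : S -> S := invF diag_inj.
Lemma diagK : cancel diag diagV. Proof. exact: invF_f. Qed.
Lemma diagVK : cancel diagV diag. Proof. exact: f_invF. Qed.

Definition addx x (g : structure_group) := g * sgen (actX g^-1 x).
Definition subx x (g : structure_group) := g / sgen (diagV (actX g^-1 x)).

Lemma actX_sgenV x : actX (sgen x)^-1 x = diag x.
Proof.
apply: (can_inj (actXK (sgen x))).
by rewrite actXVK actX_gen lamVK.
Qed.

Lemma addxK x : cancel (addx x) (subx x).
Proof.
move=> g; rewrite /subx /addx invgM actXM actX_sgenV diagK.
by rewrite mulgK.
Qed.

Lemma subxK x : cancel (subx x) (addx x).
Proof.
move=> g; rewrite /subx /addx invgM invgK actXM.
set u := diagV _; suff -> : actX (sgen u) (actX g^-1 x) = u by rewrite mulgVK.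
have -> : actX g^-1 x = diag u by rewrite diagVK.
by rewrite actX_gen lamVK.
Qed.

Lemma sgen_sig u v : sgen u * sgen (lamV u v) = sgen v * sgen (lamV v (dop v u)).
Proof. by rewrite sgenE lamVK /dop lamK. Qed.

Lemma addx_rel u v : derived_rel u v -> wact subx addx u =1 wact subx addx v.
Proof.
have rA x z g : addx z (addx x g) = addx (dop z x) (addx z g).
  rewrite /addx !invgM !actXM -!mulgA; congr (_ * _).
  have lV a : actX (sgen a)^-1 =1 lamV a.
    move=> t; apply: (can_inj (actXK (sgen a))).
    by rewrite actXVK actX_gen lamVK.
  by rewrite !lV actX_sig sgen_sig.
move=> [x [y [-> ->]]] g /=; rewrite -sigE; set z := λ_[S] x y.
apply: (can_inj (addxK x)); rewrite subxK; apply: (can_inj (addxK z)).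
by rewrite rA !subxK.
Qed.

(* The inverse turns the left action of [pact] into a right action. *)
Definition brace_piV (a : derived_group) : structure_group :=
  pact subx addx a^-1 1.

Lemma pi_addx g x : brace_pi (addx x g) = brace_pi g * dgen x.
Proof. by rewrite /addx pi_cocycle pi_gen lamA_gen actXVK. Qed.

Lemma piV1 : brace_piV 1 = 1.
Proof.
rewrite /brace_piV invg1.
by rewrite (pact1 subxK addxK addx_rel).
Qed.

Lemma piV_gen a x : brace_piV (a * dgen x) = addx x (brace_piV a).
Proof.
rewrite /brace_piV invgM (pactM subxK addxK addx_rel).
by rewrite (pact_genV subxK addxK addx_rel).
Qed.

Lemma piV_genV a x : brace_piV (a / dgen x) = subx x (brace_piV a).
Proof.
rewrite /brace_piV invgM invgK (pactM subxK addxK addx_rel).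
by rewrite (pact_gen subxK addxK addx_rel).
Qed.

Lemma piVK : cancel brace_piV brace_pi.
Proof.
move=> a; rewrite -[a]invgK; move: a^-1 => {}a.
elim/pres_ind: a => [|x a IH|x a IH].
- by rewrite invg1 piV1 pi1.
- rewrite invgM piV_genV; apply: (@mulIg _ (dgen x)).
  by rewrite -pi_addx subxK mulgVK IH.
- by rewrite invgM invgK piV_gen pi_addx IH.
Qed.

Lemma derived_group_indr (P : derived_group -> Prop) :
  P 1 -> (forall a x, P a -> P (a * dgen x)) ->
  (forall a x, P a -> P (a / dgen x)) -> forall a, P a.
Proof.
move=> P1 PM PV a; rewrite -[a]invgK; move: a^-1 => {}a.
elim/pres_ind: a => [|x a IH|x a IH]; first by rewrite invg1.
- by rewrite invgM; apply: PV.
- by rewrite invgM invgK; apply: PM.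
Qed.

Lemma addx_mull x y g : addx (λ_[S] x y) (sgen x * g) = sgen x * addx y g.
Proof. by rewrite /addx invgM actXM -actX_gen actXK mulgA. Qed.

Lemma piV_affx x a : brace_piV (affx x a) = sgen x * brace_piV a.
Proof.
elim/derived_group_indr: a => [|a y IH|a y IH].
- rewrite /affx lamA_1 mulg1 -[dgen x]mul1g piV_gen piV1 /addx invg1 actX1.
  by rewrite mul1g mulg1.
- by rewrite /affx lamAM lamA_sgen mulgA !piV_gen -/(affx x a) IH addx_mull.
- apply: (can_inj (addxK (λ_[S] x y))).
  rewrite addx_mull -!piV_gen /affx -mulgA -lamA_sgen -lamAM mulgVK.
  exact: IH.
Qed.

Lemma pi_mull x g : brace_pi (sgen x * g) = affx x (brace_pi g).
Proof. by rewrite pi_cocycle pi_gen. Qed.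

Lemma piK : cancel brace_pi brace_piV.
Proof.
elim/pres_ind => [|x g IH|x g IH]; first by rewrite pi1 piV1.
  by rewrite pi_mull piV_affx IH.
apply: (@mulgI _ (sgen x)); rewrite mulVKg -piV_affx -pi_mull mulVKg.
exact: IH.
Qed.

Lemma pi_bij : bijective brace_pi.
Proof. by exists brace_piV; [exact: piK|exact: piVK]. Qed.

Definition brace_add (g h : structure_group) : structure_group :=
  brace_piV (brace_pi g * brace_pi h).
Definition brace_opp (g : structure_group) : structure_group :=
  brace_piV (brace_pi g)^-1.

Lemma pi_add g h : brace_pi (brace_add g h) = brace_pi g * brace_pi h.
Proof. exact: piVK. Qed.
Lemma pi_opp g : brace_pi (brace_opp g) = (brace_pi g)^-1.
Proof. exact: piVK. Qed.

Lemma brace_addA : associative brace_add.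
Proof. by move=> a b c; apply: (can_inj piK); rewrite !pi_add mulgA. Qed.
Lemma brace_add0 : left_id 1 brace_add.
Proof. by move=> a; apply: (can_inj piK); rewrite pi_add pi1 mul1g. Qed.
Lemma brace_0add : right_id 1 brace_add.
Proof. by move=> a; apply: (can_inj piK); rewrite pi_add pi1 mulg1. Qed.
Lemma brace_addN : left_inverse 1 brace_opp brace_add.
Proof. by move=> a; apply: (can_inj piK); rewrite pi_add pi_opp mulVg pi1. Qed.
Lemma brace_Nadd : right_inverse 1 brace_opp brace_add.
Proof. by move=> a; apply: (can_inj piK); rewrite pi_add pi_opp mulgV pi1. Qed.

Lemma brace_distr a b c :
  a * brace_add b c = brace_add (brace_add (a * b) (brace_opp a)) (a * c).
Proof.
apply: (can_inj piK).
by rewrite pi_cocycle !pi_add pi_opp !pi_cocycle lamAM !mulgA mulgVK.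
Qed.

(* The group (G,+): the set G(X,r) with the transported addition, again
   written multiplicatively as a [groupType]. *)
Definition additive_group : Type := structure_group.
HB.instance Definition _ := Choice.copy additive_group structure_group.
HB.instance Definition _ := isGroup.Build additive_group
  brace_addA brace_add0 brace_0add brace_addN brace_Nadd.

End StructureGroup.

Section AbstractGroups.
Local Open Scope classical_set_scope.
Variable G : groupType.

Definition is_subgroup (H : set G) : Prop :=
  [/\ H 1, forall x y, H x -> H y -> H (x * y) & forall x, H x -> H x^-1].

Definition generated (A : set G) : set G := smallest is_subgroup A.

Definition commutator_set (A B : set G) : set G :=
  generated [set [~ p.1, p.2] | p in A `*` B].

Fixpoint lower_central (n : nat) : set G :=
  if n is m.+1 then commutator_set (lower_central m) [set: G] else [set: G].

Definition nilpotent_group : Prop :=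
  exists n : nat, lower_central n = [set (1 : G)].

Definition torsion : set G := [set x | exists2 n, (0 < n)%N & x ^+ n = 1].

End AbstractGroups.

Arguments nilpotent_group : clear implicits.
Arguments torsion : clear implicits.

(* [G,G]_+ as a subset of G *)
Definition additive_commutator (S : finSolution) : set (structure_group S) :=
  @commutator_set (additive_group S) [set: _]%classic [set: _]%classic.
Arguments additive_commutator : clear implicits.

(* Main.v *)
(** Let A = A_gr(X,r) and let [deg : A -> Z^X] count letters up to conjugacy in
    A. Its kernel is [A, A], since modulo commutators only the degrees of a word
    matter, and it is finite by Dietzmann's argument: the m-th powers of the
    generators are central for m = |Sym(X)|, and m equal letters can be collected
    out of every long word. If (G,∘) is nilpotent, the automorphisms λ_g act
    unipotently on A / [A, A]; having finite order, they act trivially. So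
    [deg ∘ π] is a homomorphism from (G,∘) to the torsion-free group Z^X, its
    kernel contains T(G), and being finite it consists of torsion elements. *)
Require Import Defs.
From mathcomp Require Import all_boot.
From mathcomp Require Import ssralg ssrnum ssrint fingroup perm cyclic.
From mathcomp Require Import boolp classical_sets functions cardinality.

Set Implicit Arguments.
Unset Strict Implicit.
Unset Printing Implicit Defensive.

Import GRing.Theory.

Local Open Scope group_scope.

(** * Permutations of finite types and counting *)

Section Permutations.
Variables (T : finType) (f : T -> T).
Hypothesis f_inj : injective f.

Lemma iter_card_perm (y : T) : iter #|{perm T}| f y = y.
Proof.
have -> : iter #|{perm T}| f y = (perm f_inj ^+ #|{perm T}|) y.
  by rewrite permX; apply: eq_iter => z; rewrite permE.
have := @expg_cardG _ [set: {perm T}]%G (perm f_inj) (finset.in_setT _).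
by rewrite cardsT => ->; rewrite perm1.
Qed.

End Permutations.

Lemma card_perm_gt0 (T : finType) : 0 < #|{perm T}|.
Proof. by apply/card_gt0P; exists 1%g. Qed.

Lemma size_sum_count (T : finType) (s : seq T) :
  size s = \sum_(x : T) count_mem x s.
Proof.
elim: s => [|y s IH] /=; first by rewrite big1.
rewrite big_split /= -IH (bigD1 y) //= eqxx big1 ?addn0 //.
by move=> x; rewrite eq_sym => /negbTE ->.
Qed.

Lemma pigeonhole_nat (T : finType) (f : nat -> T) :
  exists i j, i < j /\ f i = f j.
Proof.
case: (pselect (injective (fun i : 'I_(#|T|).+1 => f i))) => [/leq_card|].
  by rewrite card_ord ltnn.
move=> /existsNP[i /existsNP[j /not_implyP[fij ij]]].
case: (ltngtP i j) => [lt|lt|/val_inj//]; first by exists i, j.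
by exists j, i.
Qed.

(** * The degree map on A_gr(X,r) *)

Section Degree.
Variable S : finSolution.
Notation A := (derived_group S).
Implicit Types (x y z : S) (a b : A) (s t u w : seq S).

Local Notation "'Z^X'" := {ffun S -> int}.

Definition conj_gen x : {set S} := [set y | `[< exists a, dgen y = dgen x ^ a >]].

Lemma conj_gen_eq x y a : dgen y = dgen x ^ a -> conj_gen x = conj_gen y.
Proof.
move=> xy; apply/finset.setP => z; rewrite !inE; apply/asboolP/asboolP => -[b zb].
  by exists (a^-1 * b); rewrite xy -conjgM mulKVg.
by exists (a * b); rewrite conjgM -xy.
Qed.

(* A chosen letter conjugate to [x] in A_gr(X,r). *)
Definition orep x : S := odflt x [pick y in conj_gen x].

Lemma mem_conj_gen x : x \in conj_gen x.
Proof. by rewrite inE; apply/asboolP; exists 1; rewrite conjg1. Qed.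

Lemma orepP x : exists a, dgen (orep x) = dgen x ^ a.
Proof.
rewrite /orep; case: pickP => [y|/(_ x)]; rewrite ?mem_conj_gen //.
by rewrite inE => /asboolP.
Qed.

Lemma orep_eq x y a : dgen y = dgen x ^ a -> orep y = orep x.
Proof.
move=> /conj_gen_eq xy; rewrite /orep xy; case: pickP => // /(_ y).
by rewrite mem_conj_gen.
Qed.

Lemma dgenJ z x : dgen x ^ dgen z = dgen (dop z x).
Proof. by rewrite conjgE dgen_sig mulKg. Qed.

Lemma orep_dop z x : orep (dop z x) = orep x.
Proof. by apply: (orep_eq (a := dgen z)); rewrite dgenJ. Qed.

Definition delta x : Z^X := [ffun y => (orep x == y)%:R]%R.

Definition deg_add x (f : Z^X) : Z^X := (f + delta x)%R.
Definition deg_sub x (f : Z^X) : Z^X := (f - delta x)%R.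

(* [deg a y] is the exponent sum in [a] of the letters conjugate to [y],
   if [y] is a chosen representative, and [0] otherwise. *)
Definition deg a : Z^X := pact deg_add deg_sub a 0%R.

Let addK x : cancel (deg_add x) (deg_sub x).
Proof. by move=> f; rewrite /deg_add /deg_sub addrK. Qed.
Let subK x : cancel (deg_sub x) (deg_add x).
Proof. by move=> f; rewrite /deg_add /deg_sub subrK. Qed.
Let degR (p q : word S) : derived_rel p q ->
  wact deg_add deg_sub p =1 wact deg_add deg_sub q.
Proof.
move=> [x [y [-> ->]]] f /=; rewrite -sigE /deg_add /delta orep_dop.
by rewrite -!addrA [X in (f + X)%R]addrC.
Qed.

Lemma deg1 : deg 1 = 0%R.
Proof. exact: pact1. Qed.

Lemma deg_gen x : deg (dgen x) = delta x.
Proof. by rewrite /deg pact_gen // /deg_add add0r. Qed.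

Lemma degM a b : deg (a * b) = (deg a + deg b)%R.
Proof.
rewrite {1}/deg pactM // -/(deg b); move: (deg b) => f.
elim/pres_ind: a => [|x a IH|x a IH].
- by rewrite deg1 pact1 // add0r.
- rewrite /deg !pactM // !pact_gen // IH /deg_add addrAC; congr (_ + _)%R.
- by rewrite /deg !pactM // !pact_genV // IH /deg_sub addrAC.
Qed.

Lemma degV a : deg a^-1 = (- deg a)%R.
Proof. by apply: (addrI (deg a)); rewrite -degM mulgV deg1 subrr. Qed.

Lemma degX a n : deg (a ^+ n) = (deg a *+ n)%R.
Proof.
elim: n => [|n IH]; first by rewrite expg0 deg1.
by rewrite expgS degM IH mulrS.
Qed.

Lemma ffun_mulrnI n (f g : Z^X) : 0 < n -> (f *+ n = g *+ n)%R -> f = g.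
Proof.
move=> n0 fg; apply/ffunP => y.
have := congr1 (fun h : Z^X => h y) fg; rewrite !ffunMnE.
exact: Num.Theory.pmulrnI.
Qed.

(** [F] will be [dgen], or the map sending [x] to the central power [dgen x ^+ m]. *)
Definition wprod (F : S -> A) s : A := foldr (fun x a => F x * a) 1 s.

Lemma wprod_cat F s t : wprod F (s ++ t) = wprod F s * wprod F t.
Proof. by elim: s => [|x s IH] /=; rewrite ?mul1g // IH mulgA. Qed.

Lemma deg_wprod F n s : (forall x, deg (F x) = (delta x *+ n)%R) ->
  deg (wprod F s) = ([ffun y => (count_mem y (map orep s))%:R] *+ n)%R.
Proof.
move=> Fn; elim: s => [|x s IH] /=.
  by rewrite deg1; apply/ffunP => y; rewrite ffunMnE !ffunE /= mul0rn.
rewrite degM IH Fn -mulrnDl; congr (_ *+ n)%R.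
by apply/ffunP => y; rewrite !ffunE natrD.
Qed.

(** * Positive words modulo a normal subgroup *)

Section Congruence.
Variables (N : set A) (F : S -> A) (n : nat).
Hypothesis sN : is_subgroup N.
Hypothesis nN : forall a b, N a -> N (a ^ b).
Hypothesis n_gt0 : 0 < n.
Hypothesis degF : forall x, deg (F x) = (delta x *+ n)%R.
Hypothesis comF : forall s t,
  N ((wprod F s * wprod F t) * (wprod F t * wprod F s)^-1).
Hypothesis orepF : forall x, N (F x * (F (orep x))^-1).

Local Notation "a ≡ b" := (N (a * b^-1)) (at level 70).

Let crefl a : a ≡ a.
Proof. by rewrite mulgV; case: sN. Qed.
Let csym a b : a ≡ b -> b ≡ a.
Proof. by case: sN => _ _ h /h; rewrite invgM invgK. Qed.
Let ctrans b a c : a ≡ b -> b ≡ c -> a ≡ c.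
Proof. by case: sN => _ h _ ab bc; have := h _ _ ab bc; rewrite mulgA mulgVK. Qed.
Let cmul a b c d : a ≡ b -> c ≡ d -> a * c ≡ b * d.
Proof.
move=> ab cd; apply: (ctrans (b := a * d)).
  have := nN a^-1 cd; rewrite conjgE invgK invgM !mulgA.
  by [].
by rewrite invgM mulgA mulgK.
Qed.

Lemma wprod_perm s t : perm_eq s t -> wprod F s ≡ wprod F t.
Proof.
move=> st; move: (crefl (wprod F s)).
apply: (catCA_perm_ind (P := fun t => wprod F s ≡ wprod F t) _ st).
move=> s1 s2 s3 h; apply: ctrans h _; rewrite !catA !(wprod_cat _ (_ ++ _)).
by apply: cmul; rewrite // !wprod_cat.
Qed.

Lemma wprod_orep s : wprod F s ≡ wprod F (map orep s).
Proof. by elim: s => [|x s IH] /=; [exact: crefl|apply: cmul]. Qed.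

(** Equal degrees make [map orep s] and [map orep t] permutations of each other, and modulo [N]
    letters may be replaced by their representatives and reordered. *)
Lemma wprod_deg s t : deg (wprod F s) = deg (wprod F t) -> wprod F s ≡ wprod F t.
Proof.
rewrite !(deg_wprod _ degF) => /(ffun_mulrnI n_gt0)/ffunP st.
apply: ctrans (wprod_orep s) _; apply: ctrans (csym (wprod_orep t)).
apply: wprod_perm; apply/allP => y _ /=; apply/eqP.
by have := st y; rewrite !ffunE => /eqP; rewrite Num.Theory.eqr_nat => /eqP.
Qed.

End Congruence.

(** * Central powers, normal forms and finiteness of the kernel of [deg] *)

Local Notation m := #|{perm S}|.
Local Notation gprod := (wprod (@dgen S)).
Local Notation zprod := (wprod (fun x => dgen x ^+ m)).

(** The solution sends [(x, lamV x z)] to a pair with first entry [z] and second entry determined by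
    [dop z x]; it is injective. *)
Lemma dop_inj z : injective (dop z).
Proof.
have E x : sol_map (x, lamV x z) = (z, ρ_[S] (lamV x z) x).
  by rewrite [LHS]surjective_pairing -/(lam _ _ _) -/(rho _ _ _) lamVK.
move=> x y /(@lam_inj S z) xy; have := E x; rewrite xy -E.
by move/(bij_inj (sol_bij S)) => [].
Qed.

Lemma dgenJX z y n : dgen y ^ (dgen z ^+ n) = dgen (iter n (dop z) y).
Proof.
elim: n => [|n IH]; first by rewrite expg0 conjg1.
by rewrite expgSr conjgM IH dgenJ.
Qed.

(** Conjugation by [dgen x] permutes the letters through [dop x], and the m-th power of any
    permutation of [S] is trivial. *)
Lemma dgenXm_central x a : commute (dgen x ^+ m) a.
Proof.
have cg y : commute (dgen x ^+ m) (dgen y).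
  rewrite /commute [RHS]conjgC dgenJX iter_card_perm //.
  exact: dop_inj.
elim/pres_ind: a => [|y a IH|y a IH]; first exact: commute1.
  by apply: commuteM => //; apply: cg.
by apply: commuteM => //; apply/commuteV/cg.
Qed.

Lemma zprod_central s a : commute (zprod s) a.
Proof.
elim: s => [|x s IH] /=; first exact/commute_sym/commute1.
by apply/commute_sym/commuteM; apply/commute_sym => //; apply: dgenXm_central.
Qed.

Lemma gprod_nseq x n : gprod (nseq n x) = dgen x ^+ n.
Proof. by elim: n => [|n IH] //=; rewrite IH expgS. Qed.

(** Each [x] moved to the front conjugates the letters it passes, and a conjugate of a letter by a
    letter is again a letter, so no length is gained. *)
Lemma gprod_pull x w : exists w',
  size w' + count_mem x w = size w /\
  gprod w = dgen x ^+ count_mem x w * gprod w'.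
Proof.
elim: w => [|y w [w' [sw IH]]]; first by exists [::]; rewrite /= expg0 mul1g.
have [->|xy] := eqVneq y x; rewrite /= ?eqxx ?(negbTE xy).
  by exists w'; rewrite -sw addnCA IH expgS mulgA.
exists (iter (count_mem x w) (dop x) y :: w').
by rewrite /= add0n addSn sw IH !mulgA -dgenJX -conjgC.
Qed.

Lemma gprod_shorten w : exists u t,
  (size u <= #|S| * m)%N /\ gprod w = gprod u * zprod t.
Proof.
have [n] := ubnP (size w); elim: n w => // n IH w; rewrite ltnS => wn.
have [sw|sw] := leqP (size w) (#|S| * m).
  by exists w, [::]; rewrite mulg1.
(* If every letter occurred fewer than [m] times, the word would not exceed the bound. *)
have [x xm] : exists x, (m <= count_mem x w)%N.
  apply: contrapT => /forallNP h; move: sw; rewrite ltnNge => /negP; apply.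
  rewrite size_sum_count -sum_nat_const leq_sum // => x _.
  by rewrite ltnW // ltnNge; apply/negP/h.
have [w' [sw' ->]] := gprod_pull x w.
rewrite -(subnK xm) addnC expgD -mulgA -(gprod_nseq x (_ - _)) -wprod_cat.
have [|u [t [su ->]]] := IH (nseq (count_mem x w - m) x ++ w').
  rewrite size_cat size_nseq; apply: leq_trans wn; rewrite -sw'.
  by rewrite addnC ltn_add2l -subn_gt0 subKn // card_perm_gt0.
exists u, (x :: t); split=> //=.
by rewrite !mulgA dgenXm_central.
Qed.

(** An inverse letter is the (m-1)-st power of the letter divided by its central m-th power; the
    latter serves as a denominator. *)
Lemma gprod_frac a : exists s u, a * zprod s = gprod u.
Proof.
elim/pres_ind: a => [|x a [s [u IH]]|x a [s [u IH]]].
- by exists [::], [::]; rewrite mulg1.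
- by exists s, (x :: u); rewrite /= -IH mulgA.
- exists (x :: s), (nseq m.-1 x ++ u); rewrite wprod_cat gprod_nseq -IH /=.
  rewrite -/(dgen x) -!mulgA [a * (_ * _)]mulgA -dgenXm_central !mulgA.
  have -> : dgen x ^+ m = dgen x * dgen x ^+ m.-1.
    by rewrite -expgS prednK // card_perm_gt0.
  by rewrite mulKg.
Qed.

Lemma normal_form a : exists w s t,
  (size w <= #|S| * m)%N /\ a * zprod s = gprod w * zprod t.
Proof.
have [s [u asu]] := gprod_frac a.
by have [w [t [sw uw]]] := gprod_shorten u; exists w, s, t; rewrite asu.
Qed.

Lemma deg0_mem (N : set A) a : is_subgroup N -> (forall b c, N [~ b, c]) ->
  deg a = 0%R -> N a.
Proof.
move=> sN cN a0; have [N1 NM NV] := sN.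
have nN b c : N b -> N (b ^ c).
  by move=> Nb; rewrite -(mulVKg b (b ^ c)) -commgEl; apply: NM.
have [s [u asu]] := gprod_frac a.
(* The denominator is itself a positive word, with the same degree as the numerator [gprod u], so
   the two are congruent modulo [N]. *)
have zg : zprod s = gprod (flatten (map (nseq m) s)).
  by elim: (s) => [|x s' IH] //=; rewrite wprod_cat gprod_nseq IH.
rewrite -(mulgK (zprod s) a) asu zg; apply: (wprod_deg (n := 1)) => //.
- exact: deg_gen.
- by move=> v w; rewrite [gprod v * _]commgCV mulgK.
- move=> x; have [c ->] := orepP x; rewrite -[dgen x ^ c](mulVKg (dgen x)) -commgEl.
  rewrite invgM mulgA -{1}[dgen x]invgK -mulgA -conjgE.
  by apply: nN; apply: NV.
- by rewrite -asu degM a0 add0r zg.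
Qed.

(** Here [N] is trivial: central m-th powers commute, and conjugate letters have the same one. *)
Lemma zprod_deg s t : deg (zprod s) = deg (zprod t) -> zprod s = zprod t.
Proof.
move=> st; apply: divg1_eq; apply: (@wprod_deg [set (1 : A)] _ m) => //.
- split=> // [x y -> ->|x ->]; [exact: mulg1|exact: invg1].
- by move=> a b ->; apply: conj1g.
- exact: card_perm_gt0.
- by move=> x; rewrite degX deg_gen.
- by move=> u v; rewrite /= zprod_central mulgV.
- move=> x /=; have [c ->] := orepP x.
  by rewrite -conjXg conjgE [_ * c]dgenXm_central mulKg mulgV.
Qed.

Lemma finite_deg0 : finite_set [set a | deg a = 0%R].
Proof.
pose nf w a := deg a = 0%R /\ exists s t, a * zprod s = gprod w * zprod t.
have nf_inj w a b : nf w a -> nf w b -> a = b.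
  move=> [a0 [s [t ast]]] [b0 [s' [t' bst]]].
  have da := congr1 deg ast; have db := congr1 deg bst.
  rewrite !degM a0 b0 !add0r in da db.
  have zz : zprod (s ++ t') = zprod (s' ++ t).
    by apply: zprod_deg; rewrite !wprod_cat !degM da db addrAC.
  (* With this common central factor, both sides become [gprod w] times the same central element. *)
  apply: (@mulIg _ (zprod (s ++ t'))); rewrite {2}zz !wprod_cat.
  by rewrite !mulgA ast bst -!mulgA; congr (_ * _); apply: zprod_central.
(* The tagged tuples enumerate the words within the bound; by [nf_inj] each one accounts for at most
   one element of degree 0, and the default 1 is harmless. *)
pose f (p : {n : 'I_(#|S| * m).+1 & n.-tuple S}) : A := xget 1 (nf (tagged p)).
apply: (@sub_finite_set _ _ (f @` setT)); last first.
  exact/finite_image/finite_finset.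
move=> a /= a0; have [w [s [t [sw ast]]]] := normal_form a.
have nw : nf w a by split=> //; exists s, t.
exists (existT _ (Ordinal (sw : size w < _.+1)) (in_tuple w)) => //.
by apply: (nf_inj w) => //; apply: xgetPex; exists a.
Qed.

Lemma deg_comm a b : deg [~ a, b] = 0%R.
Proof.
rewrite commgEl conjgE !degM !degV.
by rewrite [(deg a + deg b)%R]addrC addKr addNr.
Qed.

Lemma lamAV (g : structure_group S) a : lamA g a^-1 = (lamA g a)^-1.
Proof. by apply: (@mulgI _ (lamA g a)); rewrite -lamAM !mulgV lamA_1. Qed.

(* The kernel of [deg] is the smallest subgroup containing the commutators, so
   every endomorphism preserves it. *)
Lemma deg_lamA_eq (g : structure_group S) a b :
  deg a = deg b -> deg (lamA g a) = deg (lamA g b).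
Proof.
move=> ab; apply/eqP; rewrite -subr_eq0 -degV -degM -lamAV -lamAM; apply/eqP.
apply: (@deg0_mem [set c | deg (lamA g c) = 0%R] (a * b^-1)).
- split=> [|c d /= c0 d0|c /= c0]; first by rewrite /= lamA_1 deg1.
    by rewrite lamAM degM c0 d0 addr0.
  by rewrite lamAV degV c0 oppr0.
- by move=> c d /=; rewrite commgEl conjgE !lamAM !lamAV -conjgE -commgEl deg_comm.
- by rewrite degM degV ab subrr.
Qed.

End Degree.

(** * Nilpotency and the action of G on degrees *)

Section StructureGroupAction.
Variable S : finSolution.
Notation G := (structure_group S).
Notation A := (derived_group S).
Implicit Types (g h t : G) (a b : A).

Definition trivial_act g := forall x, actX g x = x.

Lemma trivial_actM g h : trivial_act g -> trivial_act h -> trivial_act (g * h).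
Proof. by move=> tg th x; rewrite actXM th tg. Qed.

Lemma trivial_actV g : trivial_act g -> trivial_act g^-1.
Proof. by move=> tg x; rewrite -{1}[x]tg actXK. Qed.

Lemma trivial_actJ g h : trivial_act g -> trivial_act (g ^ h).
Proof. by move=> tg x; rewrite conjgE !actXM tg actXK. Qed.

Lemma trivial_act_comm g h : trivial_act g -> trivial_act [~ g, h].
Proof.
move=> tg; rewrite commgEl.
by apply: trivial_actM; [apply: trivial_actV|apply: trivial_actJ].
Qed.

Lemma lamA_trivial g : trivial_act g -> lamA g =1 id.
Proof.
move=> tg; apply: presented_morph_ext => // [|x]; first exact: lamAM.
by rewrite -/(dgen x) lamA_gen tg.
Qed.

Lemma lamA_piV g : lamA g (brace_pi g^-1) = (brace_pi g)^-1.
Proof. by apply: (@mulgI _ (brace_pi g)); rewrite -pi_cocycle !mulgV pi1. Qed.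

(** In the cocycle expansion of t^-1 g t g^-1 the two contributions of [g] cancel in degree, as [t]
    acts trivially. Commuting with [g^-1] is what produces λ_g rather than its inverse. *)
Lemma deg_pi_comm g t : trivial_act t ->
  deg (brace_pi [~ t, g^-1]) = (deg (lamA g (brace_pi t)) - deg (brace_pi t))%R.
Proof.
move=> tt; rewrite commgEl conjgE invgK !pi_cocycle !degM.
rewrite -(lamA_trivial tt (brace_pi t^-1)) lamA_piV.
rewrite !(lamA_trivial (trivial_actV tt)) !lamAM !degM.
have -> : lamA t (brace_pi g^-1) = brace_pi g^-1 by apply: lamA_trivial.
by rewrite lamA_piV !degV [(_ - deg (brace_pi g))%R]addrC addNKr addrC.
Qed.

Lemma deg_lamA_iter g a b j : deg (lamA g a) = (deg a + deg b)%R ->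
  deg (lamA g b) = deg b -> deg (lamA (g ^+ j) a) = (deg a + deg b *+ j)%R.
Proof.
move=> ga gb; elim: j => [|j IH]; first by rewrite expg0 lamA1 addr0.
rewrite expgS lamA_comp.
have -> : deg (lamA g (lamA (g ^+ j) a)) = deg (lamA g (a * b ^+ j)).
  by apply: deg_lamA_eq; rewrite IH degM degX.
have gX i : deg (lamA g (b ^+ i)) = (deg b *+ i)%R.
  elim: i => [|i IHi]; first by rewrite expg0 lamA_1 deg1.
  by rewrite expgS lamAM degM gb IHi mulrS.
by rewrite lamAM degM ga gX mulrS addrA.
Qed.

Lemma trivial_act_expg g : trivial_act (g ^+ #|{perm S}|).
Proof.
move=> x; rewrite -[RHS](iter_card_perm (can_inj (actXK g)) x).
elim: #|_| => [|n IH]; first by rewrite expg0 actX1.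
by rewrite expgS actXM IH.
Qed.

(** In degree, λ_g adds b = (λ_g - 1)t to t and fixes b, so its j-th power adds jb. For j the order
    of Sym(X) this power is the identity; hence jb = 0, and b = 0 as Z^X is torsion-free. *)
Lemma deg_pi_comm_descent g t : trivial_act t ->
  deg (brace_pi [~ [~ t, g^-1], g^-1]) = 0%R ->
  deg (brace_pi [~ t, g^-1]) = 0%R.
Proof.
move=> tt; have tc := trivial_act_comm (g^-1) tt.
have dc := deg_pi_comm g tt.
rewrite (deg_pi_comm g tc) => /eqP; rewrite subr_eq0 => /eqP cc.
have := @deg_lamA_iter g (brace_pi t) (brace_pi [~ t, g^-1]) #|{perm S}|.
rewrite dc addrC subrK => /(_ erefl); rewrite -dc => /(_ cc).
rewrite (lamA_trivial (@trivial_act_expg g)) -[LHS]addr0 => /addrI/esym h.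
by apply: (ffun_mulrnI (card_perm_gt0 S)); rewrite h mul0rn.
Qed.

Lemma iter_comm_lower_central g t n :
  lower_central n (iter n (fun u => [~ u, g^-1]) t).
Proof.
elim: n => [//|n IH]; apply: sub_gen_smallest.
by exists (iter n (fun u => [~ u, g^-1]) t, g^-1).
Qed.

(* Modulo the kernel of [deg], [t] is a translation and the map sending [t] to
   [~ t, g^-1] acts as [λ_g - 1]. So λ_g is unipotent on the translations; having
   finite order it fixes them. *)
Lemma nilpotent_deg_lamA_trivial g t : nilpotent_group G -> trivial_act t ->
  deg (lamA g (brace_pi t)) = deg (brace_pi t).
Proof.
move=> [n nil] tt; apply/eqP; rewrite -subr_eq0 -deg_pi_comm //; apply/eqP.
(* One commutator beyond the nilpotency bound, so that the induction ends at a single commutator,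
   which is the goal. *)
have : deg (brace_pi (iter n.+1 (fun u => [~ u, g^-1]) t)) = 0%R.
  have := iter_comm_lower_central g t n; rewrite nil /= => ->.
  by rewrite comm1g pi1 deg1.
elim: n {nil} t tt => [//|n IH] t tt; rewrite iterSr => h.
by apply: deg_pi_comm_descent => //; apply: IH h; apply: trivial_act_comm.
Qed.

(* Two of the elements [i b] of (G,+) act in the same way on X, and their
   quotient in (G,∘) acts trivially and equals [(j - i) b] in A_gr(X,r). *)
Lemma nilpotent_deg_lamA g b : nilpotent_group G -> deg (lamA g b) = deg b.
Proof.
move=> nil; pose h i := brace_piV (b ^+ i).
have [i [j [ij /permP hij]]] :=
  pigeonhole_nat (fun i => perm (can_inj (actXK (h i)))).
have act x : actX (h j) x = actX (h i) x by have := hij x; rewrite !permE.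
have tt : trivial_act (h j * (h i)^-1) by move=> x; rewrite actXM act actXVK.
have lam_act a : lamA (h j) a = lamA (h i) a.
  move: a; apply: presented_morph_ext => [||x]; try exact: lamAM.
  by rewrite -/(dgen x) !lamA_gen act.
have pit : brace_pi (h j * (h i)^-1) = b ^+ (j - i).
  by rewrite pi_cocycle lam_act lamA_piV !piVK expgnFr // ltnW.
apply: (ffun_mulrnI (n := j - i)); first by rewrite subn_gt0.
have := nilpotent_deg_lamA_trivial g nil tt; rewrite pit degX => <-.
elim: (j - i) => [|n IH]; first by rewrite expg0 lamA_1 deg1.
by rewrite expgS lamAM degM -IH mulrS.
Qed.

Lemma deg_pi_hom g h : nilpotent_group G ->
  deg (brace_pi (g * h)) = (deg (brace_pi g) + deg (brace_pi h))%R.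
Proof. by move=> nil; rewrite pi_cocycle degM nilpotent_deg_lamA. Qed.

Lemma finite_deg_pi0 : finite_set [set g : G | deg (brace_pi g) = 0%R].
Proof.
apply: sub_finite_set (finite_image (@brace_piV S) (@finite_deg0 S)).
by move=> g /= g0; exists (brace_pi g) => //; apply: piK.
Qed.

Lemma torsion_deg_pi0 : nilpotent_group G ->
  torsion G = [set g : G | deg (brace_pi g) = 0%R]%classic.
Proof.
move=> nil; have degX g n : deg (brace_pi (g ^+ n)) = (deg (brace_pi g) *+ n)%R.
  elim: n => [|n IH]; first by rewrite expg0 pi1 deg1.
  by rewrite expgS deg_pi_hom // IH mulrS.
apply/seteqP; split=> g /=.
  move=> [n n0 gn]; apply: (ffun_mulrnI n0).
  by rewrite -degX gn pi1 deg1 mul0rn.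
move=> g0; have /finite_seqP[s sE] := finite_deg_pi0.
have gs n : g ^+ n \in s.
  have : [set h : G | deg (brace_pi h) = 0%R]%classic (g ^+ n) by rewrite /= degX g0 mul0rn.
  by rewrite sE.
(* The position in [s] maps the powers of [g] into a finite type, so two of them coincide; the
   successor makes the ordinal type nonempty for [inord]. *)
have [i [j [ij]]] :=
  pigeonhole_nat (fun n => inord (index (g ^+ n) s) : 'I_(size s).+1).
move/(congr1 (@nat_of_ord _)); rewrite !inordK ?ltnS ?index_size // => /(congr1 (nth 1 s)).
rewrite !nth_index // => gij; exists (j - i); first by rewrite subn_gt0.
by rewrite (expgnFr g (ltnW ij)) gij mulgV.
Qed.

End StructureGroupAction.

(** * The additive commutator subgroup as the kernel of [deg] *)

Lemma generated_subgroup (G : groupType) (B : set G) : is_subgroup (Defs.generated B).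
Proof.
split=> [H [[]]//|x y Bx By H HB|x Bx H HB]; have [[_ HM HV] _] := HB.
  by apply: HM; [apply: Bx|apply: By].
exact: HV (Bx _ HB).
Qed.

Lemma additive_commutatorE (S : finSolution) :
  additive_commutator S = [set g | deg (brace_pi g) = 0%R]%classic.
Proof.
have [C1 CM CV] : @is_subgroup (additive_group S) (additive_commutator S).
  exact: generated_subgroup.
have commE (a b : additive_group S) :
    brace_pi [~ a, b] = [~ brace_pi a, brace_pi b].
  by rewrite [LHS]pi_add pi_opp [X in _ * X]pi_add pi_opp pi_add.
apply/seteqP; split.
  apply: smallest_sub.
    split=> [|a b a0 b0|a a0]; first by rewrite /= pi1 deg1.
      by rewrite /= [brace_pi _]pi_add degM a0 b0 addr0.
    by rewrite /= [brace_pi _]pi_opp degV a0 oppr0.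
  by move=> _ [[a b] _ <-]; rewrite /= commE deg_comm.
move=> g g0; rewrite -[g]piK.
(* The image of [G,G]_+ under π is a subgroup of A_gr(X,r) containing all commutators, hence the
   whole kernel of [deg]. *)
apply: (@deg0_mem S [set a | additive_commutator S (brace_piV a)]%classic) g0.
  split=> [|a b Na Nb|a Na]; first by rewrite /= piV1.
    by have := CM _ _ Na Nb; rewrite [_ * _]/(brace_add _ _) /brace_add !piVK.
  by have := CV _ Na; rewrite [_^-1]/(brace_opp _) /brace_opp piVK.
move=> a b; apply: sub_gen_smallest; exists (brace_piV a, brace_piV b) => //.
by apply: (can_inj (@piK S)); rewrite /= commE !piVK.
Qed.

Theorem proposition4p17 (S : finSolution) :
  multipermutation S -> nilpotent_group (structure_group S) ->
  finite_set (torsion (structure_group S)) /\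
  torsion (structure_group S) = additive_commutator S.
Proof.
move=> _ nil; rewrite torsion_deg_pi0 // additive_commutatorE.
by split=> //; apply: finite_deg_pi0.
Qed.
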